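(* The parity family $\mathrm{PAR}=(\mathrm{PAR}_n)_{n\in\mathbb{N}}$ belongs to $\mathrm{IS}^1{:}B(2n+3)$; that is, there is $h:\mathbb{N}\to\mathbb{N}$ and $m\in\mathbb{N}$ with $h(n)\le 2n+3$ for all $n\ge m$, such that for every $n\in\mathbb{N}$ some instruction sequence in $\mathrm{IS}^1$ computes $\mathrm{PAR}_n$ and has length at most $h(n)$.
   Context: Booleans are $\mathrm{F}$ and $\mathrm{T}$. An instruction sequence is a finite sequence $u_1;u_2;\dots;u_k$ of primitive instructions; its length is $k$. Basic instructions are: $\mathrm{in}{:}i.\mathrm{get}$ ($i\ge1$), $\mathrm{out}.\mathrm{set}{:}b$ ($b\in\{\mathrm{F},\mathrm{T}\}$), $\mathrm{aux}{:}i.\mathrm{get}$, $\mathrm{aux}{:}i.\mathrm{set}{:}b$, $\mathrm{aux}{:}i.\mathrm{com}$ ($i\ge1$). Each names a Boolean register ($\mathrm{in}{:}i$ input, $\mathrm{out}$ output, $\mathrm{aux}{:}i$ auxiliary) and a command: $\mathrm{get}$ leaves the register unchanged and replies its content; $\mathrm{set}{:}b$ sets the content to $b$ and replies $b$; $\mathrm{com}$ complements the content and replies the new content. Primitive instructions: for each basic instruction $a$, plain $a$, positive test ${+}a$, negative test ${-}a$; forward jumps $\#l$ ($l\in\mathbb{N}$); termination $!$. Execution starts at $u_1$. ${+}a$ executes $a$ and proceeds with the next instruction if the reply is $\mathrm{T}$, otherwise skips the next instruction and proceeds with the one after; ${-}a$ likewise with replies reversed; plain $a$ executes $a$ and proceeds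 with the next instruction; $\#l$ proceeds with the $l$th next instruction; $!$ terminates. If $l=0$ or there is no instruction to proceed with, inaction occurs (no termination). $X$ computes $f:\{\mathrm{F},\mathrm{T}\}^n\to\{\mathrm{F},\mathrm{T}\}$ if there is $k\in\mathbb{N}$ (at least every auxiliary index used in $X$) such that for all $b_1,\dots,b_n$: starting with $\mathrm{in}{:}i$ containing $b_i$, $\mathrm{out}$ containing $\mathrm{F}$, and $\mathrm{aux}{:}1,\dots,\mathrm{aux}{:}k$ containing $\mathrm{F}$, execution terminates with $\mathrm{out}$ containing $f(b_1,\dots,b_n)$. $\mathrm{IS}^k$ denotes the set of instruction sequences in which no instruction of the form $\mathrm{aux}{:}i.c$, ${+}\mathrm{aux}{:}i.c$, ${-}\mathrm{aux}{:}i.c$ with $i>k$ occurs. For a set $\mathcal{I}$ of instruction sequences and $f:\mathbb{N}\to\mathbb{N}$, $\mathcal{I}{:}B(f(n))$ is the class of Boolean function families $(f_n)_{n\in\mathbb{N}}$ ($f_n$ $n$-ary) for which there exists $h:\mathbb{N}\to\mathbb{N}$ with $h(n)\le f(n)$ for all sufficiently large $n$ such that for all $n$ there is $X\in\mathcal{I}$ computing $f_n$ with length at most $h(n)$. $\mathrm{PAR}_n(b_1,\dots,b_n)=\mathrm{T}$ iff the number of $\mathrm{T}$'s among $b_1,\dots,b_n$ is odd. *)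

(* Defs.v *)
From mathcomp Require Import all_boot.

Set Implicit Arguments.
Unset Strict Implicit.
Unset Printing Implicit Defensive.

Definition index1 := {i : nat | 0 < i}.

Inductive command := Get | Set_ of bool | Com.

(* (new content, reply) for a register with content c. *)
Definition process (m : command) (c : bool) : bool * bool :=
  match m with
  | Get => (c, c)
  | Set_ b => (b, b)
  | Com => (~~ c, ~~ c)
  end.

(* Each register is equipped only with the commands that may be issued to it:
   inputs can only be read and the output can only be set. *)
Inductive basic :=
  | InGet of index1
  | OutSet of bool
  | AuxCmd of index1 & command.

Inductive primitive :=
  | Plain of basic
  | PosTest of basic
  | NegTest of basic
  | Jump of nat
  | Halt.

Record iseq := ISeq {
  instrs :> seq primitive;
  instrs_gt0 : 0 < size instrs
}.

Definition basic_aux_le (k : nat) (a : basic) : bool :=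
  if a is AuxCmd i _ then val i <= k else true.

Definition aux_le (k : nat) (u : primitive) : bool :=
  match u with
  | Plain a | PosTest a | NegTest a => basic_aux_le k a
  | Jump _ | Halt => true
  end.

Definition IS (k : nat) (X : iseq) : Prop := all (aux_le k) X.

(* Register in:i (resp. aux:i) is item i.-1 of [inputs] (resp. [auxs]); a
   register whose index exceeds the size of the list does not exist. *)
Record state := State {
  inputs : seq bool;
  output : bool;
  auxs : seq bool
}.

(* New state and reply; [None] when the named register does not exist. *)
Definition exec (a : basic) (s : state) : option (state * bool) :=
  match a with
  | InGet i =>
      if onth (inputs s) (val i).-1 is Some c
      then Some (s, (process Get c).2) else None
  | OutSet b =>
      let: (c', r) := process (Set_ b) (output s) in
      Some (State (inputs s) c' (auxs s), r)
  | AuxCmd i m =>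
      if onth (auxs s) (val i).-1 is Some c then
        let: (c', r) := process m c in
        Some (State (inputs s) (output s)
                    (set_nth false (auxs s) (val i).-1 c'), r)
      else None
  end.

(* Positions are counted from 0. [None] covers both termination and inaction;
   a position outside X has no successor, which gives inaction there. *)
Definition step (X : seq primitive) (p : nat) (s : state) :
    option (nat * state) :=
  match onth X p with
  | Some (Plain a) =>
      if exec a s is Some (s', _) then Some (p.+1, s') else None
  | Some (PosTest a) =>
      if exec a s is Some (s', r)
      then Some (if r then p.+1 else p.+2, s') else None
  | Some (NegTest a) =>
      if exec a s is Some (s', r)
      then Some (if r then p.+2 else p.+1, s') else None
  | Some (Jump l) => if l == 0 then None else Some (p + l, s)
  | Some Halt | None => None
  end.

(* [terminates X p s t]: execution of X from position p in state s reaches a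
   termination instruction, in state t. *)
Inductive terminates (X : seq primitive) : nat -> state -> state -> Prop :=
  | TermHalt p s : onth X p = Some Halt -> terminates X p s s
  | TermStep p s p' s' t :
      step X p s = Some (p', s') -> terminates X p' s' t ->
      terminates X p s t.

Definition computes (n : nat) (X : iseq) (f : n.-tuple bool -> bool) : Prop :=
  exists k : nat, all (aux_le k) X /\
    forall b : n.-tuple bool, exists t : state,
      terminates X 0 (State b false (nseq k false)) t /\ output t = f b.

Definition bool_family := forall n : nat, n.-tuple bool -> bool.

(* The class I:B(g(n)); only finitely many n may violate h n <= g n. *)
Definition in_B (I : iseq -> Prop) (g : nat -> nat) (F : bool_family) : Prop :=
  exists h : nat -> nat,
    (exists m : nat, forall n, m <= n -> h n <= g n) /\
    forall n, exists X : iseq, [/\ I X, computes X (F n) & size X <= h n].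

Definition PAR : bool_family := fun n b => odd (count_mem true b).

(* Main.v *)
Require Import Defs.
From mathcomp Require Import all_boot.

(* The auxiliary register accumulates the parity of the inputs read so far:
   each input costs the two instructions [+in:i.get; aux:1.com], and the final
   [+aux:1.get; out.set:T; !] copies the result to the output. *)

(** Register numbers start at 1 and list positions at 0: [idx i] names the register stored at
    position [i]. *)
Definition idx (i : nat) : index1 := exist (fun i => 0 < i) i.+1 isT.

(** Giving the instruction as a function of its position, instead of concatenating two-instruction
    blocks, makes lookup in the prefix a case of [nth_mkseq]. *)
Definition parity_instr (p : nat) : primitive :=
  if odd p then Plain (AuxCmd (idx 0) Com) else PosTest (InGet (idx p./2)).

Definition parity_tail : seq primitive :=
  [:: PosTest (AuxCmd (idx 0) Get); Plain (OutSet true); Halt].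

Definition parity_seq (n : nat) : seq primitive :=
  mkseq parity_instr n.*2 ++ parity_tail.

Lemma size_parity_seq n : size (parity_seq n) = 2 * n + 3.
Proof. by rewrite size_cat size_mkseq mul2n. Qed.

Lemma parity_seq_gt0 n : 0 < size (parity_seq n).
Proof. by rewrite size_parity_seq addn3. Qed.

Definition parity_iseq (n : nat) : iseq := ISeq (parity_seq_gt0 n).

Lemma parity_seq_IS1 n : IS 1 (parity_iseq n).
Proof.
rewrite /IS /= all_cat andbT all_map; apply/allP => p _ /=.
by rewrite /parity_instr; case: odd.
Qed.

Lemma onth_parity_seq n p : p < n.*2 ->
  onth (parity_seq n) p = Some (parity_instr p).
Proof.
move=> ltp; rewrite (onthE (parity_seq n)) map_cat nth_cat size_map size_mkseq.
rewrite ltp (nth_map (parity_instr 0)) ?size_mkseq //.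
by rewrite nth_mkseq.
Qed.

Lemma onth_parity_tail n p : onth (parity_seq n) (n.*2 + p) = onth parity_tail p.
Proof.
by rewrite !onthE map_cat nth_cat size_map size_mkseq ltnNge leq_addr addKn.
Qed.

(** Since [terminates] grows by adding steps at the front, the loop invariant is put in the
    hypothesis: a run from the middle is pulled back to position 0, one input at a time. *)
Lemma terminates_parity_prefix n (b : n.-tuple bool) i t : i <= n ->
  terminates (parity_seq n) i.*2
    (State b false [:: odd (count_mem true (take i b))]) t ->
  terminates (parity_seq n) 0 (State b false [:: false]) t.
Proof.
elim: i => [|i IHi] lein; first by rewrite take0.
(* What remains is one round, from [i.*2] to [i.+1.*2], followed by the run [termS]. *)
move=> termS; apply: IHi (ltnW lein) _.
have onth_b : onth b i = Some (nth false b i).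
  by rewrite onthE (nth_map false) ?size_tuple.
move: termS; rewrite (take_nth false) ?size_tuple // -cats1 count_cat oddD /=.
rewrite addn0 doubleS.
have get_i : onth (parity_seq n) i.*2 = Some (PosTest (InGet (idx i))).
  by rewrite onth_parity_seq ?ltn_double // /parity_instr odd_double doubleK.
have com_i : onth (parity_seq n) i.*2.+1 = Some (Plain (AuxCmd (idx 0) Com)).
  by rewrite onth_parity_seq ?ltn_Sdouble // /parity_instr /= odd_double.
(* On T the complement is executed, adding 1 to the parity; on F the test skips it and lands
   directly on the next round. *)
case: (nth false b i) onth_b => onth_b /= termS.
- apply: TermStep; first by rewrite /step get_i /= onth_b.
  apply: TermStep; first by rewrite /step com_i /=.
  by move: termS; rewrite addbT.
- apply: TermStep; first by rewrite /step get_i /= onth_b.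
  by move: termS; rewrite addbF.
Qed.

Lemma terminates_parity_tail n (s : seq bool) c :
  terminates (parity_seq n) n.*2 (State s false [:: c]) (State s c [:: c]).
Proof.
have get_aux := onth_parity_tail n 0; rewrite addn0 in get_aux.
have set_out := onth_parity_tail n 1; rewrite addn1 in set_out.
have halt := onth_parity_tail n 2; rewrite addn2 in halt.
apply: TermStep; first by rewrite /step get_aux /=.
(* For F the test skips to [Halt], and the output is right because it is still F. *)
case: c => /=; last exact: TermHalt.
apply: TermStep; first by rewrite /step set_out /=.
exact: TermHalt.
Qed.

Lemma parity_iseq_computes n : computes (parity_iseq n) (@PAR n).
Proof.
exists 1; split; first exact: parity_seq_IS1.
move=> b; exists (State b (PAR b) [:: PAR b]); split=> //.
apply: (terminates_parity_prefix n b n) => //.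
(* After [n] rounds the prefix read is all of [b], so [aux:1] holds [PAR b]. *)
rewrite take_oversize ?size_tuple //.
exact: terminates_parity_tail.
Qed.

Theorem theorem2 : in_B (IS 1) (fun n : nat => 2 * n + 3) PAR.
Proof.
exists (fun n => 2 * n + 3); split; first by exists 0.
move=> n; exists (parity_iseq n); split.
- exact: parity_seq_IS1.
- exact: parity_iseq_computes.
- by rewrite /= size_parity_seq.
Qed.
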